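(* In the Brownian-with-drift setting of the context, let $k\ge2$ and suppose that the barriers $\mathbf b^*_{2k-1}=(b_1^*,\dots,b_{2k-1}^* )$ produced by the algorithm are well defined, in the sense that $$b_1^*<\dots<b_{2k-3}^*<b_{2k-2}^*<b_{2k-1}^*,\qquad F(b^*_{2k-2},b^*_{2k-2};\mathbf b^*_{2k-3})=F(b^*_{2k-2},b^*_{2k-1};\mathbf b^*_{2k-3}),$$ and that $(\mathcal L-q)H(v_{2k-1};\mathbf b^*_{2k-1})>0$ for some $v_{2k-1}>b^*_{2k-1}$. Assume that there exists $\epsilon_{2k-1}>0$ such that $$\partial_zF(v,v+;\mathbf b^*_{2k-1})=(\mathcal L-q)H(v;\mathbf b^*_{2k-1})<0\quad\text{for } v\in(b^*_{2k},b^*_{2k}+\epsilon_{2k-1}).$$ Then $b^*_{2k}$ and $b^*_{2k+1}$ given by the algorithm are well defined and satisfy $$b^*_{2k-1}<b^*_{2k}<b^*_{2k+1}\quad\text{and}\quad b^*_{2k}<c_{2k-1}.$$ Moreover, $$F(b^*_{2k},b^*_{2k};\mathbf b^*_{2k-1})=F(b^*_{2k},b^*_{2k+1};\mathbf b^*_{2k-1}).$$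
   Context: **Setting.** Fix $\mu\in\mathbb R$, $\sigma>0$, $q>0$, and let $\mathcal Lf=\frac{\sigma^2}2f''+\mu f'$ (generator of $X_t=x+\mu t+\sigma B_t$, $B$ a Brownian motion). With $s=\sqrt{\mu^2+2q\sigma^2}$, $\Phi(q)=(s-\mu)/\sigma^2$, $\zeta_1=(s+\mu)/\sigma^2$, for $x\ge0$ let $W(x)=\frac1s(e^{\Phi(q)x}-e^{-\zeta_1x})$, $Z(x)=\frac qs\big(\frac{e^{\Phi(q)x}}{\Phi(q)}+\frac{e^{-\zeta_1x}}{\zeta_1}\big)$. Let $g:(0,\infty)\to(0,\infty)$ be twice continuously differentiable with $g(z)=o(e^{\Phi(q)z})$ as $z\to\infty$, and put $G(x)=\int_0^xg(y)\,dy$. **Auxiliary functions.** For an increasing non-negative sequence $b_1<b_2<\dots$ write $\mathbf b_{2j+1}=(b_1,\dots,b_{2j+1})$. Define $H(x;\mathbf b_1)=G(x)-G(b_1)+g(b_1)\frac{W(b_1)}{W'(b_1)}$ and, for $j\ge1$, $$\phi(x;\mathbf b_{2j+1})=H(b_{2j};\mathbf b_{2j-1})Z(x-b_{2j})+W(x-b_{2j})\frac{g(b_{2j+1})-qH(b_{2j};\mathbf b_{2j-1})W(b_{2j+1}-b_{2j})}{W'(b_{2j+1}-b_{2j})},$$ $$H(x;\mathbf b_{2j+1})=G(x)-G(b_{2j+1})+\phi(b_{2j+1};\mathbf b_{2j+1}).$$ Thus $(\mathcal L-q)H(v;\mathbf b_{2j+1})=\frac{\sigma^2}2g'(v)+\mu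 g(v)-qH(v;\mathbf b_{2j+1})$. For $b_{2j+1}\le v<z$, $$F(v,z;\mathbf b_{2j+1})=\frac{g(z)-qH(v;\mathbf b_{2j+1})W(z-v)}{W'(z-v)},\qquad F(v,v;\mathbf b_{2j+1}):=\lim_{z\downarrow v}F(v,z;\mathbf b_{2j+1})=\tfrac{\sigma^2}2g(v);$$ $\partial_zF(v,v+;\mathbf b_{2j+1})$ denotes the limit of $\partial_zF(v,z;\mathbf b_{2j+1})$ as $z\downarrow v$, and one has $\partial_zF(v,v+;\mathbf b_{2j+1})=(\mathcal L-q)H(v;\mathbf b_{2j+1})$. **Algorithm.** With $F(u)=g(u)/W'(u)$, $u\ge0$, let $b_1^*=\sup\{u\ge0:F(u)\ge F(x)\ \forall x\ge0\}$. For $j\ge1$, given $\mathbf b^*_{2j-1}=(b_1^*,\dots,b_{2j-1}^* )$: stop if $(\mathcal L-q)H(x;\mathbf b^*_{2j-1})\le0$ for all $x\ge b^*_{2j-1}$. Otherwise let $\mathcal P_{2j-1}$ be the set of $\tilde v>b^*_{2j-1}$ such that, for some $\varepsilon>0$, $(\mathcal L-q)H(v;\mathbf b^*_{2j-1})$ is $\le0$ on $(\tilde v-\varepsilon,\tilde v)$, $=0$ at $\tilde v$, and $>0$ on $(\tilde v,\tilde v+\varepsilon)$; $c_{2j-1}=\min\mathcal P_{2j-1}$; $$z_{2j-1}(v)=\sup\{y\ge v:F(v,y;\mathbf b^*_{2j-1})\ge F(v,z;\mathbf b^*_{2j-1})\ \forall z\ge v\},\quad\mathcal D_{2j-1}=\{v\in[b^*_{2j-1},c_{2j-1}]:v<z_{2j-1}(v)\};$$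 $b^*_{2j}=\inf\mathcal D_{2j-1}$ and $b^*_{2j+1}=z_{2j-1}(b^*_{2j})$. *)

(* Defs.v *)
From Stdlib Require Import Reals Lra.
From Coquelicot Require Import Coquelicot.
Open Scope R_scope.

(* [c = min P] for a set of reals. *)
Definition is_min (P : R -> Prop) (c : R) : Prop :=
  P c /\ forall x, P x -> c <= x.

(* Twice continuously differentiable on (0, oo). *)
Definition C2_pos (g : R -> R) : Prop :=
  forall x, 0 < x ->
    ex_derive g x /\ ex_derive (Derive g) x /\ continuous (Derive (Derive g)) x.

Section Barriers.

Context (mu sigma q : R) (g : R -> R).

Definition sroot : R := sqrt (mu ^ 2 + 2 * q * sigma ^ 2).
Definition Phi : R := (sroot - mu) / sigma ^ 2.
Definition zeta1 : R := (sroot + mu) / sigma ^ 2.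

(* Wq and Zq are only evaluated at x >= 0.  As the formula for Wq is smooth on R,
   [Derive Wq 0] is the right derivative W'(0+) = 2 / sigma^2. *)
Definition Wq (x : R) : R := / sroot * (exp (Phi * x) - exp (- zeta1 * x)).
Definition Zq (x : R) : R :=
  q / sroot * (exp (Phi * x) / Phi + exp (- zeta1 * x) / zeta1).

(* (L - q) f, where L is the generator of x + mu t + sigma B_t. *)
Definition Lq (f : R -> R) (x : R) : R :=
  sigma ^ 2 / 2 * Derive (Derive f) x + mu * Derive f x - q * f x.

(* The function g is given on (0, oo); the value [g 0], needed for F(0), is left
   arbitrary, so the natural convention g(0) = g(0+) is one instance.
   If F(u) = g(u)/W'(u) has a maximizer on [0, oo), then g is bounded near 0, so
   the existence of b_1 makes g Riemann integrable on every [0, x]. *)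
Definition G (x : R) : R := RInt g 0 x.

(* The barrier b_i of the paper is [b i]; [b 0] is not used.  The level j stands
   for the vector (b_1, ..., b_{2j+1}): [H b j x] is H(x; b_{2j+1}).
   The parameter h of [phi_of] is the value H(b_{2j}; b_{2j-1}). *)
Definition phi_of (h beven bodd x : R) : R :=
  h * Zq (x - beven)
  + Wq (x - beven) * ((g bodd - q * h * Wq (bodd - beven)) / Derive Wq (bodd - beven)).

Fixpoint H (b : nat -> R) (j : nat) (x : R) : R :=
  match j with
  | O => G x - G (b 1%nat) + g (b 1%nat) * (Wq (b 1%nat) / Derive Wq (b 1%nat))
  | S i =>
      let beven := b (2 * j)%nat in
      let bodd := b (2 * j + 1)%nat in
      G x - G bodd + phi_of (H b i beven) beven bodd bodd
  end.

(* F(v, z; b_{2j+1}).  For z = v > 0 the formula gives the right limit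
   F(v, v) = sigma^2/2 * g(v), because W(0) = 0 and W'(0) = 2 / sigma^2. *)
Definition F (b : nat -> R) (j : nat) (v z : R) : R :=
  (g z - q * H b j v * Wq (z - v)) / Derive Wq (z - v).

Lemma F_diag (b : nat -> R) (j : nat) (v : R) :
  0 < sigma -> 0 < q -> F b j v v = sigma ^ 2 / 2 * g v.
Proof.
intros hs hq.
assert (h2 : 0 < sigma ^ 2) by (apply pow_lt; exact hs).
assert (hr : 0 < sroot).
{ apply sqrt_lt_R0; assert (h := pow2_ge_0 mu).
  assert (0 < q * sigma ^ 2) by (apply Rmult_lt_0_compat; assumption); lra. }
assert (W0 : Wq 0 = 0).
{ unfold Wq; rewrite !Rmult_0_r; ring. }
assert (dW0 : Derive Wq 0 = 2 / sigma ^ 2).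
{ apply is_derive_unique; unfold Wq; auto_derive; [exact I|].
  rewrite !Rmult_0_r, exp_0; unfold Phi, zeta1; field; split; lra. }
unfold F; replace (v - v) with 0 by ring; rewrite W0, dW0; field; lra.
Qed.

Definition F1 (u : R) : R := g u / Derive Wq u.

Definition is_b1 (b1 : R) : Prop :=
  is_lub_Rbar (fun u => 0 <= u /\ forall x, 0 <= x -> F1 x <= F1 u) (Finite b1).

(* P_{2j+1} *)
Definition Pset (b : nat -> R) (j : nat) (v : R) : Prop :=
  b (2 * j + 1)%nat < v /\
  exists eps : R, 0 < eps /\
    (forall x, v - eps < x < v -> Lq (H b j) x <= 0) /\
    Lq (H b j) v = 0 /\
    (forall x, v < x < v + eps -> 0 < Lq (H b j) x).

(* z_{2j+1}(v), as an extended real (-oo if there is no maximizer). *)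
Definition zsup (b : nat -> R) (j : nat) (v : R) : Rbar :=
  Lub_Rbar (fun y => v <= y /\ forall z, v <= z -> F b j v z <= F b j v y).

(* D_{2j+1}, given c = c_{2j+1}. *)
Definition Dset (b : nat -> R) (j : nat) (c v : R) : Prop :=
  b (2 * j + 1)%nat <= v <= c /\ Rbar_lt (Finite v) (zsup b j v).

(* inf D_{2j+1}, as an extended real (+oo if D_{2j+1} is empty). *)
Definition infD (b : nat -> R) (j : nat) (c : R) : Rbar := Glb_Rbar (Dset b j c).

(* From (b_1, ..., b_{2j+1}) the algorithm does not stop, c = c_{2j+1}, and it
   returns b_{2j+2} = beven and b_{2j+3} = bodd as real numbers.
   For b_1 = 0 the derivatives of H at x = 0 in the stopping test are irrelevant:
   the existence of c already gives a point x > b_1 with (L - q) H(x) > 0. *)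
Definition algorithm_step (b : nat -> R) (j : nat) (c beven bodd : R) : Prop :=
  ~ (forall x, b (2 * j + 1)%nat <= x -> Lq (H b j) x <= 0) /\
  is_min (Pset b j) c /\
  infD b j c = Finite beven /\
  zsup b j beven = Finite bodd.

(* (b_1, ..., b_{2j+1}) is produced by the algorithm. *)
Definition produced (b : nat -> R) (j : nat) : Prop :=
  is_b1 (b 1%nat) /\
  forall i, (i < j)%nat ->
    exists c, algorithm_step b i c (b (2 * i + 2)%nat) (b (2 * i + 3)%nat).

End Barriers.

(* Main.v *)
Require Import Defs.
From Stdlib Require Import Reals Lra Lia Classical.
From Coquelicot Require Import Coquelicot.
Open Scope R_scope.

(* Let [gap v z = W'(z - v) (F(v,v) - F(v,z))].  Since [(L - q) W = 0],
   [d/dv gap v z = W'(z - v) (L - q)H(v)] and [gap z z = 0], so by the mean value theorem the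
   sign of [(L - q)H] on [(v, z)] determines that of [gap v z].  A point [v] lies in
   D_{2k-1} iff [gap v z <= 0] for some [z > v]: the growth condition on [g] and [H >= 0] make
   [gap v z] positive for large [z], so maximizers of [F(v, .)] exist.  At [c] the gap is
   negative just to the right, so D is nonempty, and [c <> inf D] by the sign of [(L - q)H].
   With [v0 = inf D], negativity of [(L - q)H] to the right of [v0] keeps the points [z]
   belonging to [v] near [v0] away from [v0]; by compactness [gap v0 z <= 0] for some
   [z > v0], while [gap v z > 0] for [v < v0] gives [gap v0 >= 0] in the limit, hence the
   equality.  Finally [v0 <> b_{2k-1}]: by the addition formulas for [W] and [W'],
   [gap b_{2k-1}] is a positive multiple of the gap between [F(b_{2k-2}, .)] and its
   maximum, attained last at [b_{2k-1}]. *)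

(** * Riemann integrability of bounded functions that are continuous except perhaps at the left
    endpoint *)

Lemma is_RInt_Riemann_sum (f : R -> R) (a b l : R) :
  a < b -> is_RInt f a b l ->
  forall eps : posreal, Riemann_fine a b (fun ptd => Rabs (Riemann_sum f ptd - l) < eps).
Proof.
intros hab hf eps.
assert (h := proj1 (filterlim_locally _ _) hf eps); cbv beta in h.
revert h; apply filter_imp; intros ptd h.
rewrite sign_eq_1 in h by lra; unfold scal in h; simpl in h; unfold mult in h; simpl in h.
rewrite Rmult_1_l in h; exact h.
Qed.

(** Cauchy criterion. With [f1], [f2] taken for [eps / 6], fine Riemann sums of [f] differ from
    those of [f1] by at most a sum of [f2], which is below [eps / 3], and those of [f1] are within
    [eps / 6] of [l1]. So all fine sums of [f] lie within [eps / 2] of [l1]. *)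
Lemma ex_RInt_squeeze (f : R -> R) (a b : R) :
  a < b ->
  (forall eps : posreal, exists (f1 f2 : R -> R) (l : R),
     ex_RInt f1 a b /\ is_RInt f2 a b l /\ l < eps /\
     forall x, a <= x <= b -> Rabs (f x - f1 x) <= f2 x) ->
  ex_RInt f a b.
Proof.
intros hab hf; apply (proj1 (filterlim_locally_cauchy (U := R_CompleteSpace) (F := Riemann_fine a b)
  (fun ptd => scal (sign (b - a)) (Riemann_sum f ptd)))).
intros eps.
assert (he : 0 < eps / 6) by (destruct eps; simpl; lra).
destruct (hf (mkposreal _ he)) as (f1 & f2 & l2 & [l1 h1] & h2 & hl2 & hle).
exists (fun ptd =>
  (pointed_subdiv ptd /\ SF_h ptd = Rmin a b /\ seq.last (SF_h ptd) (SF_lx ptd) = Rmax a b) /\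
  Rabs (Riemann_sum f1 ptd - l1) < eps / 6 /\ Rabs (Riemann_sum f2 ptd - l2) < eps / 6).
split.
- apply filter_and.
  + unfold Riemann_fine, within; apply filter_forall; tauto.
  + apply filter_and; [apply (is_RInt_Riemann_sum f1 a b l1 hab h1 (mkposreal _ he))
                      |apply (is_RInt_Riemann_sum f2 a b l2 hab h2 (mkposreal _ he))].
- assert (key : forall ptd,
    (pointed_subdiv ptd /\ SF_h ptd = Rmin a b /\ seq.last (SF_h ptd) (SF_lx ptd) = Rmax a b) /\
    Rabs (Riemann_sum f1 ptd - l1) < eps / 6 /\ Rabs (Riemann_sum f2 ptd - l2) < eps / 6 ->
    Rabs (Riemann_sum f ptd - l1) < eps / 2).
  { intros ptd [(hp & ha & hb) (h3 & h4)].
    rewrite Rmin_left in ha by lra; rewrite Rmax_right in hb by lra.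
    assert (h5 : Rabs (Riemann_sum f ptd - Riemann_sum f1 ptd) <= Riemann_sum f2 ptd).
    { assert (h6 := Riemann_sum_minus f f1 ptd).
      unfold minus, plus, opp in h6; simpl in h6.
      unfold Rminus; rewrite <- h6.
      apply (Riemann_sum_norm (fun x => f x + - f1 x) f2 ptd hp).
      rewrite hb, ha; intros t ht; apply (hle t ht). }
    simpl in hl2; apply Rabs_def2 in h3; apply Rabs_def2 in h4.
    apply Rabs_le_between in h5; apply Rabs_def1; lra. }
  intros u v hu hv; apply key in hu; apply key in hv.
  apply Rabs_def2 in hu; apply Rabs_def2 in hv.
  rewrite sign_eq_1 by lra.
  unfold ball; simpl; unfold AbsRing_ball, abs, minus, plus, opp, scal, mult; simpl.
  change (Rabs (1 * Riemann_sum f v - 1 * Riemann_sum f u) < eps).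
  rewrite !Rmult_1_l; apply Rabs_def1; lra.
Qed.

Lemma ex_RInt_bounded (f : R -> R) (a b M : R) :
  a < b ->
  (forall x, a < x <= b -> continuous f x) ->
  (forall x, a <= x <= b -> Rabs (f x) <= M) ->
  ex_RInt f a b.
Proof.
intros hab hc hM; apply (ex_RInt_squeeze f a b hab); intros eps.
assert (M0 : 0 <= M) by (eapply Rle_trans; [apply Rabs_pos | apply (hM a); lra]).
(* [f] is replaced by 0 on [[a, a + d)], at the cost of an error with integral at most
   [M * d < eps]; the [+ 1] covers [M = 0]. *)
set (d := Rmin (b - a) (eps / (M + 1))).
assert (he := cond_pos eps).
assert (hd : 0 < d <= b - a).
{ split; [apply Rmin_glb_lt; [lra | apply Rdiv_lt_0_compat; lra] | apply Rmin_l]. }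
assert (hd' : M * d < eps).
{ apply Rle_lt_trans with (M * (eps / (M + 1))).
  - apply Rmult_le_compat_l; [exact M0 | apply Rmin_r].
  - apply Rmult_lt_reg_r with (M + 1); [lra|].
    replace (M * (eps / (M + 1)) * (M + 1)) with (M * eps) by (field; lra); nra. }
exists (fun x => if Rlt_dec x (a + d) then 0 else f x).
exists (fun x => if Rlt_dec x (a + d) then M else 0).
exists (M * d); split; [|split; [|split; [exact hd'|]]].
- apply ex_RInt_Chasles with (a + d).
  + apply ex_RInt_ext with (fun _ => 0); [|apply ex_RInt_const].
    intros x; rewrite Rmin_left, Rmax_right by lra; intros hx.
    destruct (Rlt_dec x (a + d)); lra.
  + apply ex_RInt_ext with f.
    * intros x; rewrite Rmin_left, Rmax_right by lra; intros hx.
      destruct (Rlt_dec x (a + d)); lra.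
    * apply (ex_RInt_continuous (V := R_CompleteNormedModule)).
      intros x; rewrite Rmin_left, Rmax_right by lra; intros hx; apply hc; lra.
- set (f2 := fun x => if Rlt_dec x (a + d) then M else 0).
  assert (i1 : is_RInt f2 a (a + d) (scal (a + d - a) M)).
  { apply is_RInt_ext with (fun _ => M); [|apply (is_RInt_const (V := R_NormedModule))].
    intros x; rewrite Rmin_left, Rmax_right by lra; intros hx; unfold f2.
    destruct (Rlt_dec x (a + d)); lra. }
  assert (i2 : is_RInt f2 (a + d) b (scal (b - (a + d)) 0)).
  { apply is_RInt_ext with (fun _ => 0); [|apply (is_RInt_const (V := R_NormedModule))].
    intros x; rewrite Rmin_left, Rmax_right by lra; intros hx; unfold f2.
    destruct (Rlt_dec x (a + d)); lra. }
  replace (M * d) with (plus (scal (a + d - a) M) (scal (b - (a + d)) 0)).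
  + exact (is_RInt_Chasles _ _ _ _ _ _ i1 i2).
  + unfold plus, scal; simpl; unfold mult; simpl; ring.
- intros x hx; cbv beta.
  destruct (Rlt_dec x (a + d)).
  + rewrite Rminus_0_r; apply hM; exact hx.
  + rewrite Rminus_diag, Rabs_R0; lra.
Qed.

Lemma exp_le (x y : R) : x <= y -> exp x <= exp y.
Proof. intros [h | ->]; [left; apply exp_increasing; exact h | right; reflexivity]. Qed.

(** * Scale functions: closed forms, bounds and addition formulas *)

Section Scale.

Context (mu sigma q : R) (hsigma : 0 < sigma) (hq : 0 < q).

Local Notation s := (sroot mu sigma q).
Local Notation P := (Phi mu sigma q).
Local Notation Y := (zeta1 mu sigma q).
Local Notation W := (Wq mu sigma q).
Local Notation Z := (Zq mu sigma q).

Definition dWq (x : R) : R := / s * (P * exp (P * x) + Y * exp (- Y * x)).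

Lemma sroot_gt_abs : Rabs mu < s.
Proof.
unfold sroot; rewrite <- sqrt_Rsqr_abs.
assert (0 < q * sigma ^ 2) by (apply Rmult_lt_0_compat; [|apply pow_lt]; assumption).
apply sqrt_lt_1; unfold Rsqr; nra.
Qed.

Lemma sroot_pos : 0 < s.
Proof. assert (h := sroot_gt_abs); assert (h' := Rabs_pos mu); lra. Qed.

Lemma sigma2_pos : 0 < sigma ^ 2.
Proof. apply pow_lt; exact hsigma. Qed.

Lemma Phi_pos : 0 < P.
Proof.
assert (h := sroot_gt_abs); assert (h' := Rle_abs mu).
apply Rdiv_lt_0_compat; [lra | exact sigma2_pos].
Qed.

Lemma zeta1_pos : 0 < Y.
Proof.
assert (h := sroot_gt_abs); assert (h' := Rle_abs (- mu)); rewrite Rabs_Ropp in h'.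
apply Rdiv_lt_0_compat; [lra | exact sigma2_pos].
Qed.

(** Vieta's formulas for the roots [Phi] and [- zeta1] of sigma^2/2 x^2 + mu x - q. Once [mu], [s]
    and [q] are written through the roots, as here and in the next two lemmas, identities between
    scale functions become rational ones that [field] settles. *)
Lemma mu_eq : mu = sigma ^ 2 / 2 * (Y - P).
Proof. assert (h := sigma2_pos); unfold zeta1, Phi; field; lra. Qed.

Lemma sroot_eq : s = sigma ^ 2 / 2 * (Y + P).
Proof. assert (h := sigma2_pos); unfold zeta1, Phi; field; lra. Qed.

Lemma q_eq : q = sigma ^ 2 / 2 * (Y * P).
Proof.
assert (h := sigma2_pos).
assert (e : s * s = mu ^ 2 + 2 * q * sigma ^ 2).
{ apply sqrt_sqrt; assert (h0 := pow2_ge_0 mu); nra. }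
replace (sigma ^ 2 / 2 * (Y * P)) with ((s * s - mu ^ 2) / (2 * sigma ^ 2)).
- rewrite e; field; lra.
- unfold zeta1, Phi; field; lra.
Qed.

Lemma is_derive_Wq (x : R) : is_derive W x (dWq x).
Proof. unfold Wq, dWq; auto_derive; [exact I|ring]. Qed.

Lemma Derive_Wq (x : R) : Derive W x = dWq x.
Proof. apply is_derive_unique, is_derive_Wq. Qed.

Lemma dWq_pos (x : R) : 0 < dWq x.
Proof.
assert (h := sroot_pos); assert (hP := Phi_pos); assert (hY := zeta1_pos).
assert (e1 := exp_pos (P * x)); assert (e2 := exp_pos (- Y * x)).
apply Rmult_lt_0_compat; [apply Rinv_0_lt_compat; exact h | nra].
Qed.

Lemma Wq_0 : W 0 = 0.
Proof. unfold Wq; rewrite !Rmult_0_r; ring. Qed.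

Lemma dWq_0 : dWq 0 = 2 / sigma ^ 2.
Proof.
assert (h := sigma2_pos); assert (hP := Phi_pos); assert (hY := zeta1_pos).
unfold dWq; rewrite !Rmult_0_r, exp_0, sroot_eq; field; split; lra.
Qed.

Lemma Wq_ge_0 (x : R) : 0 <= x -> 0 <= W x.
Proof.
intros hx; assert (h := sroot_pos); assert (hP := Phi_pos); assert (hY := zeta1_pos).
apply Rmult_le_pos; [left; apply Rinv_0_lt_compat; exact h|].
assert (exp (- Y * x) <= exp (P * x)); [apply exp_le; nra | lra].
Qed.

(** The exponential growth of W' that the growth condition on [g] is compared with. *)
Lemma dWq_lower (x : R) : P / s * exp (P * x) <= dWq x.
Proof.
assert (h := sroot_pos); assert (hY := zeta1_pos).
assert (e2 := exp_pos (- Y * x)); assert (hi := Rinv_0_lt_compat _ h).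
replace (P / s * exp (P * x)) with (/ s * (P * exp (P * x))) by (unfold Rdiv; ring).
apply Rmult_le_compat_l; [lra | nra].
Qed.

Lemma dWq_upper (x X : R) : 0 <= x <= X -> dWq x <= / s * (P * exp (P * X) + Y).
Proof.
intros hx; assert (h := sroot_pos); assert (hP := Phi_pos); assert (hY := zeta1_pos).
assert (e1 : exp (P * x) <= exp (P * X)) by (apply exp_le; nra).
assert (e2 : exp (- Y * x) <= exp 0) by (apply exp_le; nra).
rewrite exp_0 in e2.
apply Rmult_le_compat_l; [left; apply Rinv_0_lt_compat; exact h | nra].
Qed.

Lemma exp_split (l a d : R) : exp (l * (a + d)) = exp (l * a) * exp (l * d).
Proof. rewrite <- exp_plus; f_equal; ring. Qed.

Ltac roots :=
  generalize q_eq, sroot_eq, Phi_pos, zeta1_pos; generalize P Y s;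
  intros p y r eq er hp hy; rewrite er, eq.

(** As functions of [d] both sides solve (L - q) f = 0, with the same value and slope at [d = 0];
    the proof checks the identity by direct computation. *)
Lemma Wq_add (a d : R) : W (a + d) = sigma ^ 2 / 2 * W a * dWq d + Z a * W d.
Proof.
assert (h := sigma2_pos); assert (hP := Phi_pos); assert (hY := zeta1_pos).
unfold Wq, Zq, dWq; rewrite !exp_split; roots; field; repeat split; lra.
Qed.

(** This is the derivative in [a] of [Wq_add], because Z' = q W. *)
Lemma dWq_add (a d : R) : dWq (a + d) = sigma ^ 2 / 2 * dWq a * dWq d + q * W a * W d.
Proof.
assert (h := sigma2_pos); assert (hP := Phi_pos); assert (hY := zeta1_pos).
unfold Wq, dWq; rewrite !exp_split; roots; field; repeat split; lra.
Qed.

(** The expression is the Wronskian of W and Z, a positive multiple of an exponential. It carries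
    the sign of [H] from one level to the next in [H_nonneg]. *)
Lemma Zq_dWq_pos (x : R) : 0 < Z x * dWq x - q * W x ^ 2.
Proof.
assert (h := sigma2_pos); assert (hP := Phi_pos); assert (hY := zeta1_pos).
replace (Z x * dWq x - q * W x ^ 2)
  with (2 / sigma ^ 2 * (exp (P * x) * exp (- Y * x))).
- assert (0 < exp (P * x) * exp (- Y * x)) by (apply Rmult_lt_0_compat; apply exp_pos).
  apply Rmult_lt_0_compat; [apply Rdiv_lt_0_compat; lra | assumption].
- unfold Wq, Zq, dWq; roots; field; repeat split; lra.
Qed.

End Scale.

Lemma continuity_pt_ex_derive (f : R -> R) (x : R) : ex_derive f x -> continuity_pt f x.
Proof. intros hf; apply derivable_continuous_pt, ex_derive_Reals_0, hf. Qed.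

(** * The gap function: derivative, signs, behaviour at infinity and compactness *)

Section Gap.

Context (mu sigma q : R) (g : R -> R) (hsigma : 0 < sigma) (hq : 0 < q).
Context (gpos : forall x, 0 < x -> 0 < g x) (gC2 : C2_pos g).
Context (ggrowth : is_lim (fun z => g z / exp (Phi mu sigma q * z)) p_infty 0).

Local Notation s := (sroot mu sigma q).
Local Notation P := (Phi mu sigma q).
Local Notation Y := (zeta1 mu sigma q).
Local Notation W := (Wq mu sigma q).
Local Notation dW := (dWq mu sigma q).

Context (h : R -> R) (hd : forall x, 0 < x -> is_derive h x (g x)).

(** [h] is any primitive of [g] on the positive axis, so that the results apply to [H] at every
    level. *)
Definition gap (v z : R) : R :=
  sigma ^ 2 / 2 * g v * dW (z - v) + q * h v * W (z - v) - g z.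

(** This is (L - q) h with h' = g substituted. *)
Definition drift (y : R) : R := sigma ^ 2 / 2 * Derive g y + mu * g y - q * h y.

Lemma continuity_pt_g (x : R) : 0 < x -> continuity_pt g x.
Proof.
intros hx; apply continuity_pt_ex_derive.
apply (gC2 x hx).
Qed.

Lemma Lq_drift (y : R) : 0 < y -> Lq mu sigma q h y = drift y.
Proof.
intros hy; unfold Lq, drift.
rewrite (is_derive_unique _ _ _ (hd y hy)).
(* The second derivative of [h] needs h' = g on a neighbourhood of [y], not only at [y]. *)
rewrite (Derive_ext_loc (Derive h) g y); [reflexivity|].
apply (locally_interval _ y 0 p_infty); [exact hy | exact I |].
intros x hx _; apply is_derive_unique, hd, hx.
Qed.

Lemma gap_diag (z : R) : gap z z = 0.
Proof.
assert (h2 := sigma2_pos sigma hsigma).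
unfold gap; rewrite Rminus_diag, Wq_0, (dWq_0 _ _ _ hsigma hq); field; lra.
Qed.

(* [W] solves [sigma^2/2 W'' + mu W' = q W], so that the derivative of the gap in its
   first argument factors. *)
Lemma is_derive_gap (y z : R) : 0 < y ->
  is_derive (fun v => gap v z) y (dW (z - y) * drift y).
Proof.
intros hy.
assert (hg : is_derive g y (Derive g y)) by (apply Derive_correct, (gC2 y hy)).
assert (hh := hd y hy).
assert (ehg : ex_derive g y) by (eexists; exact hg).
assert (ehh : ex_derive h y) by (eexists; exact hh).
unfold gap, Wq, dWq; auto_derive; [repeat split; assumption|].
rewrite (is_derive_unique h _ _ hh : Derive (fun x => h x) y = g y); unfold drift.
change (Derive (fun x => g x) y) with (Derive g y).
generalize (mu_eq mu sigma q hsigma), (sroot_eq mu sigma q hsigma),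
  (q_eq mu sigma q hsigma hq), (sigma2_pos sigma hsigma),
  (Phi_pos mu sigma q hsigma hq), (zeta1_pos mu sigma q hsigma hq).
replace (z + - y) with (z - y) by ring.
(* With the exponentials made opaque, only a rational identity in the roots remains. *)
generalize (exp (P * (z - y))), (exp (- Y * (z - y))), P, Y, s.
intros A B p y0 r em er eq h2 hp hy0; rewrite em, er, eq; field; split; lra.
Qed.

Lemma gap_MVT (v w z : R) : 0 < v -> v < w ->
  exists xi, v < xi < w /\ gap w z - gap v z = dW (z - xi) * drift xi * (w - v).
Proof.
intros hv hvw.
destruct (MVT_cor2 (fun y => gap y z) (fun y => dW (z - y) * drift y) v w hvw)
  as (xi & e & hxi).
- intros y hy; apply is_derive_Reals, is_derive_gap; lra.
- exists xi; split; [exact hxi | exact e].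
Qed.

Lemma gap_pos (v z : R) : 0 < v -> v < z ->
  (forall y, v < y < z -> drift y < 0) -> 0 < gap v z.
Proof.
intros hv hvz hL; destruct (gap_MVT v z z hv hvz) as (xi & hxi & e).
rewrite gap_diag in e; assert (hx := hL xi hxi).
assert (hw := dWq_pos mu sigma q hsigma hq (z - xi)).
assert (0 < dW (z - xi) * - drift xi) by (apply Rmult_lt_0_compat; lra); nra.
Qed.

Lemma gap_neg (v z : R) : 0 < v -> v < z ->
  (forall y, v < y < z -> 0 < drift y) -> gap v z < 0.
Proof.
intros hv hvz hL; destruct (gap_MVT v z z hv hvz) as (xi & hxi & e).
rewrite gap_diag in e; assert (hx := hL xi hxi).
assert (hw := dWq_pos mu sigma q hsigma hq (z - xi)).
assert (0 < dW (z - xi) * drift xi) by (apply Rmult_lt_0_compat; assumption); nra.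
Qed.

Lemma continuity_pt_drift (y : R) : 0 < y -> continuity_pt drift y.
Proof.
intros hy; destruct (gC2 y hy) as (h1 & h2 & _).
apply continuity_pt_ex_derive.
assert (ehh : ex_derive h y) by (eexists; apply hd, hy).
unfold drift; auto_derive; repeat split; assumption.
Qed.

Lemma continuity_pt_gap_l (v z : R) : 0 < v -> continuity_pt (fun y => gap y z) v.
Proof.
intros hv; apply continuity_pt_ex_derive.
eexists; exact (is_derive_gap v z hv).
Qed.

Lemma continuity_pt_gap_r (v z : R) : 0 < z -> continuity_pt (gap v) z.
Proof.
intros hz; apply continuity_pt_ex_derive.
assert (h1 := proj1 (gC2 z hz)); unfold gap, Wq, dWq; auto_derive; tauto.
Qed.

(** The term with [h] is nonnegative, the term with W' grows at least like exp(Phi z) uniformly in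
    [v], and [g z] is of smaller order. *)
Lemma gap_pos_at_infinity (a c : R) : 0 < a <= c -> (forall v, a <= v -> 0 <= h v) ->
  exists Z0, c <= Z0 /\ forall v z, a <= v <= c -> Z0 <= z -> 0 < gap v z.
Proof.
intros hac hpos.
destruct (continuity_ab_min g a c) as (x0 & hmin & hx0); [lra| |].
{ intros x hx; apply continuity_pt_g; lra. }
assert (hm : 0 < g x0) by (apply gpos; lra).
assert (h2 := sigma2_pos sigma hsigma); assert (hs := sroot_pos mu sigma q hsigma hq).
assert (hP := Phi_pos mu sigma q hsigma hq).
(* The coefficient of [exp (P * z)] in the lower bound of the W' term: [g v] is at least its minimum
   [g x0], and [v <= c] bounds [exp (- P * v)] from below. *)
set (C := sigma ^ 2 / 2 * g x0 * (P / s) * exp (- P * c)).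
assert (hPs : 0 < P / s) by (apply Rdiv_lt_0_compat; assumption).
assert (hC : 0 < C).
{ unfold C; repeat (exact hPs || exact hm || apply exp_pos || lra || apply Rmult_lt_0_compat). }
assert (hlim := proj2 (is_lim_spec _ _ _) ggrowth (mkposreal C hC)).
destruct hlim as (M & hM); simpl in hM.
exists (Rmax c (M + 1)); split; [apply Rmax_l|]; intros v z hv hz.
assert (hzc := Rle_trans _ _ _ (Rmax_l _ _) hz).
assert (hzM := Rle_trans _ _ _ (Rmax_r _ _) hz).
assert (hgz : g z < C * exp (P * z)).
{ assert (hb := hM z ltac:(lra)); apply Rabs_def2 in hb; destruct hb as [hb _].
  assert (he := exp_pos (P * z)); rewrite Rminus_0_r in hb.
  apply (Rmult_lt_compat_r _ _ _ he) in hb.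
  replace (g z / exp (P * z) * exp (P * z)) with (g z) in hb by (field; lra).
  exact hb. }
assert (hW : 0 <= q * h v * W (z - v)).
{ apply Rmult_le_pos; [apply Rmult_le_pos; [lra | apply hpos; lra]|].
  apply Wq_ge_0; [exact hsigma | exact hq | lra]. }
assert (hlow : C * exp (P * z) <= sigma ^ 2 / 2 * g v * dW (z - v)).
{ unfold C; rewrite !Rmult_assoc.
  apply Rmult_le_compat_l; [lra|].
  apply Rmult_le_compat; [lra | | apply hmin; lra |].
  - apply Rmult_le_pos; [lra | left; apply Rmult_lt_0_compat; apply exp_pos].
  - apply Rle_trans with (P / s * exp (P * (z - v)));
      [|apply dWq_lower; assumption].
    apply Rmult_le_compat_l; [lra|].
    rewrite <- exp_plus; apply exp_le; nra. }
unfold gap; lra.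
Qed.

(** Otherwise [gap v0] is positive to the right of [v0]. For [v] near [v0], a point [z] with
    [gap v z <= 0] cannot lie below [A], where the drift is negative, nor beyond [B], by growth. On
    [[A, B]], [gap v0] has a positive minimum [m], and passing from [v0] to [v] changes the gap too
    little to cancel it. *)
Lemma gap_nonpos_limit (v0 eps : R) : 0 < v0 -> 0 < eps ->
  (forall v, v0 <= v -> 0 <= h v) ->
  (forall y, v0 < y < v0 + eps -> drift y < 0) ->
  (forall d, 0 < d -> exists v z, v0 <= v < v0 + d /\ v < z /\ gap v z <= 0) ->
  exists z, v0 < z /\ gap v0 z <= 0.
Proof.
intros hv0 he hpos hL hlim; apply NNPP; intros hno.
assert (hgap : forall z, v0 < z -> 0 < gap v0 z).
{ intros z hz; apply Rnot_le_lt; intros hle; apply hno; exists z; split; assumption. }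
set (A := v0 + eps).
destruct (gap_pos_at_infinity v0 A) as (B & hAB & hinf); [unfold A; lra | exact hpos |].
destruct (continuity_ab_min (gap v0) A B hAB) as (z0 & hmin & hz0).
{ intros z hz; apply continuity_pt_gap_r; unfold A in hz; lra. }
destruct (continuity_ab_maj (fun y => Rabs (drift y)) v0 A) as (y0 & hmaj & hy0).
{ unfold A; lra. }
{ intros y hy; apply (continuity_pt_comp drift Rabs);
    [apply continuity_pt_drift; lra | apply Rcontinuity_abs]. }
cbv beta in hmaj; revert hmaj; generalize (Rabs_pos (drift y0)).
generalize (Rabs (drift y0)); intros K hK hmaj.
assert (hm : 0 < gap v0 z0) by (apply hgap; unfold A in hz0; lra).
revert hm hmin; generalize (gap v0 z0); intros m hm hmin.
set (w := / s * (P * exp (P * (B - v0)) + Y)).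
assert (hw : 0 < w).
{ eapply Rlt_le_trans; [apply (dWq_pos mu sigma q hsigma hq 0)|].
  apply dWq_upper; [exact hsigma | exact hq | unfold A in hAB; lra]. }
assert (hwK : 0 < w * (K + 1)) by (apply Rmult_lt_0_compat; lra).
(* Here [w] bounds W' on [[0, B - v0]] and [K] bounds the drift on [[v0, A]], so the gap drops by
   less than [m]; [K + 1] keeps the denominator positive. *)
destruct (hlim (Rmin eps (m / (w * (K + 1))))) as (v & z & hv & hvz & hle).
{ apply Rmin_glb_lt; [exact he | apply Rdiv_lt_0_compat; assumption]. }
assert (hv1 : v < A).
{ eapply Rlt_le_trans; [apply hv | apply Rplus_le_compat_l, Rmin_l]. }
assert (hv2 : v - v0 < m / (w * (K + 1))).
{ assert (hr := Rmin_r eps (m / (w * (K + 1)))); lra. }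
apply (Rmult_lt_compat_r _ _ _ hwK) in hv2.
replace (m / (w * (K + 1)) * (w * (K + 1))) with m in hv2 by (field; lra).
destruct (Rlt_or_le z A) as [hzA|hzA].
{ assert (0 < gap v z); [|lra].
  apply gap_pos; [lra | exact hvz | intros y hy; apply hL; unfold A in hzA; lra]. }
destruct (Rle_or_lt B z) as [hzB|hzB].
{ assert (0 < gap v z); [apply hinf; lra | lra]. }
destruct (Rle_lt_or_eq_dec v0 v (proj1 hv)) as [hvv|<-].
2: { assert (hg := hgap z hvz); lra. }
destruct (gap_MVT v0 v z hv0 hvv) as (xi & hxi & e).
assert (hmz := hmin z ltac:(lra)).
assert (hd1 := hmaj xi ltac:(lra)).
apply Rabs_le_between in hd1.
assert (hw1 : dW (z - xi) <= w).
{ apply dWq_upper; [exact hsigma | exact hq | lra]. }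
assert (hw0 := dWq_pos mu sigma q hsigma hq (z - xi)).
assert (hlow : - (w * (K + 1)) <= dW (z - xi) * drift xi) by nra.
nra.
Qed.

End Gap.

(** The least upper bound of the empty set is [m_infty]. *)
Lemma is_lub_Rbar_nonempty (E : R -> Prop) (r : R) : is_lub_Rbar E (Finite r) -> exists x, E x.
Proof.
intros [_ hl]; apply NNPP; intros hno.
apply (hl m_infty); intros x hx; apply hno; exists x; exact hx.
Qed.

(** * Maximizers of [F] and properties of [H] at all levels *)

Section Levels.

Context (mu sigma q : R) (g : R -> R) (hsigma : 0 < sigma) (hq : 0 < q).
Context (gpos : forall x, 0 < x -> 0 < g x) (gC2 : C2_pos g).
Context (b : nat -> R).

Local Notation Hb := (H mu sigma q g b).
Local Notation Fb := (F mu sigma q g b).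
Local Notation W := (Wq mu sigma q).
Local Notation dW := (dWq mu sigma q).
Local Notation gapb j := (gap mu sigma q g (Hb j)).

Lemma F_dWq (j : nat) (v z : R) : Fb j v z = (g z - q * Hb j v * W (z - v)) / dW (z - v).
Proof. unfold F; rewrite Derive_Wq; reflexivity. Qed.

Lemma gap_F (j : nat) (v z : R) : gapb j v z = dW (z - v) * (Fb j v v - Fb j v z).
Proof.
assert (h := dWq_pos mu sigma q hsigma hq (z - v)).
rewrite F_diag, F_dWq by assumption; unfold gap; field; lra.
Qed.

Lemma F_le_diag (j : nat) (v z : R) : Fb j v z <= Fb j v v <-> 0 <= gapb j v z.
Proof. rewrite gap_F; assert (h := dWq_pos mu sigma q hsigma hq (z - v)); nra. Qed.

Lemma F_lt_diag (j : nat) (v z : R) : Fb j v z < Fb j v v <-> 0 < gapb j v z.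
Proof. rewrite gap_F; assert (h := dWq_pos mu sigma q hsigma hq (z - v)); nra. Qed.

Lemma continuity_pt_F (j : nat) (v z : R) : 0 < z -> continuity_pt (Fb j v) z.
Proof.
intros hz; apply (continuity_pt_ext _ _ _ (fun y => eq_sym (F_dWq j v y))).
assert (h1 := proj1 (gC2 z hz)); assert (h2 := dWq_pos mu sigma q hsigma hq (z - v)).
apply continuity_pt_ex_derive; unfold Wq, dWq in *; auto_derive.
repeat split; try assumption; unfold Rminus in h2; lra.
Qed.

(** By continuity the supremum of the maximizers is itself one; an equal value further right would
    be a later maximizer. *)
Lemma zsup_spec (j : nat) (v r : R) : 0 < v -> zsup mu sigma q g b j v = Finite r ->
  v <= r /\ (forall z, v <= z -> Fb j v z <= Fb j v r) /\
  (forall z, r < z -> Fb j v z < Fb j v r).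
Proof.
intros hv hr.
assert (hl := Lub_Rbar_correct (fun y => v <= y /\ forall z, v <= z -> Fb j v z <= Fb j v y)).
fold (zsup mu sigma q g b j v) in hl; rewrite hr in hl.
destruct (is_lub_Rbar_nonempty _ _ hl) as (y & hy1 & hy2).
destruct hl as [hub hlub].
assert (hvr : v <= r).
{ apply Rle_trans with y; [exact hy1 | apply (hub y); split; assumption]. }
assert (hmax : forall z, v <= z -> Fb j v z <= Fb j v r).
{ intros z hz; apply Rnot_lt_le; intros hlt.
  (* If [F] at [r] were below its value at [z], it would be so on [(r - d, r]], leaving no maximizer
     there, and [r - d] would be a smaller upper bound. *)
  destruct (continuity_pt_F j v r (Rlt_le_trans _ _ _ hv hvr) (Fb j v z - Fb j v r))
    as (d & hd & hc); [lra|].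
  assert (hle : r <= r - d); [|lra].
  apply (hlub (Finite (r - d))); intros x [hx1 hx2].
  apply Rnot_lt_le; intros hxd.
  assert (hxr : x <= r) by (apply (hub x); split; assumption).
  assert (hzx := hx2 z hz).
  destruct (Req_dec x r) as [->|hne]; [lra|].
  assert (hc' := hc x); simpl in hc'; unfold D_x, no_cond, R_dist in hc'.
  assert (hxa : Rabs (x - r) < d) by (apply Rabs_def1; lra).
  specialize (hc' (conj (conj I (not_eq_sym hne)) hxa)).
  apply Rabs_def2 in hc'; lra. }
split; [exact hvr | split; [exact hmax|]].
intros z hz; apply Rnot_le_lt; intros hle.
assert (z <= r); [|lra].
apply (hub z); split; [lra | intros w hw].
apply Rle_trans with (Fb j v r); [apply hmax|]; assumption.
Qed.

(** Beyond some [Z0] the values fall below the diagonal one, so a maximum over [[v, Z0]] is global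
    and all maximizers are at most [Z0]. *)
Lemma zsup_finite (ggrowth : is_lim (fun z => g z / exp (Phi mu sigma q * z)) p_infty 0)
    (j : nat) (v : R) : 0 < v -> (forall x, v <= x -> 0 <= Hb j x) ->
  exists r, zsup mu sigma q g b j v = Finite r.
Proof.
intros hv hpos.
destruct (gap_pos_at_infinity mu sigma q g hsigma hq gpos gC2 ggrowth (Hb j) v v)
  as (Z0 & hZ & hinf); [lra | exact hpos |].
destruct (continuity_ab_maj (Fb j v) v Z0 hZ) as (y & hmax & hy).
{ intros z hz; apply continuity_pt_F; lra. }
assert (hl := Lub_Rbar_correct (fun y => v <= y /\ forall z, v <= z -> Fb j v z <= Fb j v y)).
fold (zsup mu sigma q g b j v) in hl.
assert (hfar : forall z, Z0 <= z -> Fb j v z < Fb j v v).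
{ intros z hz; apply F_lt_diag, hinf; lra. }
assert (h1 : Rbar_le y (zsup mu sigma q g b j v)).
{ apply (proj1 hl); split; [apply hy|]; intros z hz.
  destruct (Rle_or_lt z Z0); [apply hmax; lra|].
  left; apply Rlt_le_trans with (Fb j v v); [apply hfar; lra | apply hmax; lra]. }
assert (h2 : Rbar_le (zsup mu sigma q g b j v) Z0).
{ apply (proj2 hl); intros x [hx1 hx2]; apply Rnot_lt_le; intros hlt.
  assert (h3 := hx2 v (Rle_refl v)); assert (h4 := hfar x ltac:(lra)); lra. }
destruct (zsup mu sigma q g b j v) as [r| |]; [exists r; reflexivity | elim h2 | elim h1].
Qed.

(** A maximizer of g/W' bounds [g] by a constant times W', which is bounded on [[0, X]]; the
    arbitrary value [g 0] enters the bound separately. *)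
Lemma ex_RInt_of_is_b1 (X : R) : is_b1 mu sigma q g (b 1%nat) -> 0 < X -> ex_RInt g 0 X.
Proof.
intros hb1 hX; destruct (is_lub_Rbar_nonempty _ _ hb1) as (u & hu0 & hu).
set (w := / sroot mu sigma q * (Phi mu sigma q * exp (Phi mu sigma q * X) + zeta1 mu sigma q)).
set (m := Rabs (F1 mu sigma q g u)).
apply (ex_RInt_bounded g 0 X (Rmax (Rabs (g 0)) (m * w)) hX).
- intros x hx; apply (ex_derive_continuous (V := R_NormedModule)), (gC2 x); lra.
- intros x hx; destruct (Req_dec x 0) as [->|hx0]; [apply Rmax_l|].
  apply Rle_trans with (m * w); [|apply Rmax_r].
  assert (hg := gpos x ltac:(lra)); rewrite Rabs_pos_eq by lra.
  assert (hux := hu x ltac:(lra)); unfold F1 at 1 in hux; rewrite Derive_Wq in hux.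
  assert (hm := Rle_abs (F1 mu sigma q g u)); fold m in hm.
  assert (hd := dWq_pos mu sigma q hsigma hq x).
  assert (hw := dWq_upper mu sigma q hsigma hq x X ltac:(lra)); fold w in hw.
  apply Rle_trans with (m * dW x).
  + apply Rmult_le_reg_r with (/ dW x); [apply Rinv_0_lt_compat, hd|].
    rewrite Rmult_assoc, Rinv_r by lra; unfold Rdiv in hux; lra.
  + apply Rmult_le_compat_l; [apply Rabs_pos | exact hw].
Qed.

Context (hint : forall X, 0 < X -> ex_RInt g 0 X).

Lemma is_derive_G (x : R) : 0 < x -> is_derive (G g) x (g x).
Proof.
intros hx; apply is_derive_RInt with 0.
- apply (locally_interval _ x 0 p_infty); [exact hx | exact I |].
  intros y hy _; apply (RInt_correct (V := R_CompleteNormedModule)), hint, hy.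
- apply (ex_derive_continuous (V := R_NormedModule)), (gC2 x hx).
Qed.

Lemma H_G (j : nat) : exists C, forall x, Hb j x = G g x + C.
Proof.
destruct j; simpl; eexists; intros x; unfold Rminus; rewrite !Rplus_assoc; reflexivity.
Qed.

Lemma is_derive_H (j : nat) (x : R) : 0 < x -> is_derive (Hb j) x (g x).
Proof.
intros hx; destruct (H_G j) as (C & e).
apply (is_derive_ext (fun y => G g y + C)); [intros y; symmetry; apply e|].
rewrite <- (Rplus_0_r (g x)).
apply (is_derive_plus (V := R_NormedModule) (G g) (fun _ => C));
  [apply is_derive_G, hx | apply (is_derive_const (K := R_AbsRing) (V := R_NormedModule))].
Qed.

Lemma H_increasing (j : nat) (x y : R) : 0 <= x <= y -> Hb j x <= Hb j y.
Proof.
intros hxy; destruct (H_G j) as (C & e); rewrite !e; apply Rplus_le_compat_r.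
destruct (Req_dec y 0) as [->|hy]; [replace x with 0 by lra; apply Rle_refl|].
assert (hy' : ex_RInt g 0 y) by (apply hint; lra).
assert (h1 : ex_RInt g 0 x) 
  by (apply (ex_RInt_Chasles_1 (V := R_CompleteNormedModule) g 0 x y); [lra | exact hy']).
assert (h2 : ex_RInt g x y) 
  by (apply (ex_RInt_Chasles_2 (V := R_CompleteNormedModule) g 0 x y); [lra | exact hy']).
unfold G; rewrite <- (RInt_Chasles (V := R_CompleteNormedModule) g 0 x y h1 h2).
assert (h3 : 0 <= RInt g x y).
{ apply RInt_ge_0; [lra | exact h2 | intros z hz; left; apply gpos; lra]. }
unfold plus; simpl; lra.
Qed.

Lemma H_succ_at_barrier (i : nat) (x y : R) : b (2 * S i)%nat = x -> b (2 * S i + 1)%nat = y ->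
  Hb (S i) y = Hb i x * Zq mu sigma q (y - x) + W (y - x) * Fb i x y.
Proof.
intros <- <-; unfold F, phi_of, H; fold (Hb i); unfold phi_of; ring.
Qed.

(** Induction on the level. Since [H] increases, its value at the last barrier suffices, and there
    the Wronskian of W and Z gives the sign. *)
Lemma H_nonneg (j : nat) (x : R) : 0 <= b 1%nat ->
  (forall i, (1 <= i < 2 * j + 1)%nat -> b i < b (i + 1)%nat) ->
  b (2 * j + 1)%nat <= x -> 0 <= b (2 * j + 1)%nat /\ 0 <= Hb j x.
Proof.
intros hb1; revert x; induction j as [|i IH]; intros x hincr hx.
- split; [exact hb1|].
  apply Rle_trans with (Hb 0 (b 1%nat)); [|apply H_increasing; simpl in hx; lra].
  simpl; rewrite Derive_Wq.
  assert (hd := dWq_pos mu sigma q hsigma hq (b 1%nat)).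
  assert (hw := Wq_ge_0 mu sigma q hsigma hq (b 1%nat) hb1).
  replace (G g (b 1%nat) - G g (b 1%nat)) with 0 by ring; rewrite Rplus_0_l.
  destruct (Rle_lt_or_eq_dec _ _ hb1) as [h|<-].
  + apply Rmult_le_pos; [left; apply gpos, h | apply Rdiv_le_0_compat; assumption].
  (* If b_1 = 0, the sign of [g 0] is unknown, but W(0) = 0 cancels it. *)
  + rewrite Wq_0; unfold Rdiv; rewrite Rmult_0_l, Rmult_0_r; apply Rle_refl.
- assert (h1 := hincr (2 * i + 1)%nat ltac:(lia)).
  assert (h2 := hincr (2 * S i)%nat ltac:(lia)).
  replace (2 * i + 1 + 1)%nat with (2 * S i)%nat in h1 by lia.
  destruct (IH (b (2 * S i)%nat)) as [h0 hH]; [intros n hn; apply hincr; lia | lra |].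
  split; [lra|].
  apply Rle_trans with (Hb (S i) (b (2 * S i + 1)%nat)); [|apply H_increasing; lra].
  rewrite (H_succ_at_barrier i _ _ eq_refl eq_refl), F_dWq.
  set (d := b (2 * S i + 1)%nat - b (2 * S i)%nat).
  assert (hd := dWq_pos mu sigma q hsigma hq d).
  assert (hw := Wq_ge_0 mu sigma q hsigma hq d ltac:(unfold d; lra)).
  assert (hg := gpos (b (2 * S i + 1)%nat) ltac:(lra)).
  assert (hZ := Zq_dWq_pos mu sigma q hsigma hq d).
  set (k := Hb i (b (2 * S i)%nat)) in *.
  replace (k * Zq mu sigma q d + W d * ((g (b (2 * S i + 1)%nat) - q * k * W d) / dW d))
    with ((k * (Zq mu sigma q d * dW d - q * W d ^ 2) + W d * g (b (2 * S i + 1)%nat)) / dW d)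
    by (field; lra).
  apply Rdiv_le_0_compat; [|exact hd].
  apply Rplus_le_le_0_compat; apply Rmult_le_pos; lra.
Qed.

(* [H (S i) y] is the value at [y] of the solution of [(L - q) f = 0] with [f x = H i x]
   and [f' y = g y].  Restarting from [y] continues the same solution, so that the gap at
   [y] compares values of [F] at [x]. *)
Lemma gap_succ_at_barrier (i : nat) (x y z : R) :
  b (2 * S i)%nat = x -> b (2 * S i + 1)%nat = y ->
  gapb (S i) y z = dW (z - x) * (Fb i x y - Fb i x z).
Proof.
intros hx hy.
assert (h1 := dWq_pos mu sigma q hsigma hq (z - x)).
assert (h2 := dWq_pos mu sigma q hsigma hq (y - x)).
unfold gap; rewrite (H_succ_at_barrier i x y hx hy).
assert (hg : g y = q * Hb i x * W (y - x) + dW (y - x) * Fb i x y).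
{ rewrite F_dWq; field; lra. }
assert (hz : g z = q * Hb i x * W (z - x) + dW (z - x) * Fb i x z).
{ rewrite F_dWq; field; lra. }
rewrite hg, hz.
replace (z - x) with ((y - x) + (z - y)) by ring.
rewrite (dWq_add mu sigma q hsigma hq), (Wq_add mu sigma q hsigma hq); ring.
Qed.

End Levels.

(** * One step of the algorithm at a fixed level *)

Section Step.

Context (mu sigma q : R) (g : R -> R) (hsigma : 0 < sigma) (hq : 0 < q).
Context (gpos : forall x, 0 < x -> 0 < g x) (gC2 : C2_pos g).
Context (ggrowth : is_lim (fun z => g z / exp (Phi mu sigma q * z)) p_infty 0).
Context (hint : forall X, 0 < X -> ex_RInt g 0 X).
Context (b : nat -> R) (j : nat).

Local Notation Hj := (H mu sigma q g b j).
Local Notation Fj := (F mu sigma q g b j).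
Local Notation gapj := (gap mu sigma q g Hj).
Local Notation beta := (b (2 * j + 1)%nat).

Context (beta_pos : 0 < beta) (Hj_nonneg : forall x, beta <= x -> 0 <= Hj x).

(** If the last maximizer exceeds [v], the gap there is nonpositive; if it is [v] itself, all later
    values are strictly smaller. The inequality is weak because a tie with the diagonal already
    moves the last maximizer. *)
Lemma Dset_gap (c v : R) : beta <= v <= c ->
  Dset mu sigma q g b j c v <-> exists z, v < z /\ gapj v z <= 0.
Proof.
intros hv.
destruct (zsup_finite mu sigma q g hsigma hq gpos gC2 b ggrowth j v) as (r & hr);
  [lra | intros x hx; apply Hj_nonneg; lra |].
destruct (zsup_spec mu sigma q g hsigma hq gC2 b j v r) as (h1 & h2 & h3); [lra | exact hr |].
unfold Dset; rewrite hr; simpl; split.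
- intros [_ hlt]; exists r; split; [exact hlt|].
  apply Rnot_lt_le; intros hg; apply F_lt_diag in hg; try assumption.
  assert (h4 := h2 v (Rle_refl v)); lra.
- intros (z & hz & hg); split; [exact hv|]; apply Rnot_le_lt; intros hle.
  replace r with v in h3 by lra.
  assert (h4 := h3 z hz); apply F_lt_diag in h4; try assumption; lra.
Qed.

Lemma step_exists (c : R) :
  (forall z, beta < z -> 0 < gapj beta z) ->
  is_min (Pset mu sigma q g b j) c ->
  (exists v, beta < v /\ 0 < Lq mu sigma q Hj v) ->
  (exists eps, 0 < eps /\ forall v : R,
     Rbar_lt (infD mu sigma q g b j c) v ->
     Rbar_lt v (Rbar_plus (infD mu sigma q g b j c) eps) -> Lq mu sigma q Hj v < 0) ->
  exists beven bodd, algorithm_step mu sigma q g b j c beven bodd /\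
    beta < beven /\ beven < bodd /\ beven < c /\ Fj beven beven = Fj beven bodd.
Proof.
intros hbeta hc (v1 & hv1 & hLv1) (eps & he & hL).
assert (hd : forall x, 0 < x -> is_derive Hj x (g x)) by (apply is_derive_H; assumption).
assert (hdrift : forall y, 0 < y -> Lq mu sigma q Hj y = drift mu sigma q g Hj y).
{ apply Lq_drift; exact hd. }
destruct hc as [(hbc & e1 & he1 & hleft & hzero & hright) hmin].
assert (hDc : Dset mu sigma q g b j c c).
(* (L - q)H is positive on [(c, c + e1)], so the gap from [c] is negative there. *)
{ apply Dset_gap; [lra|]; exists (c + e1 / 2); split; [lra|]; left.
  apply gap_neg; try assumption; [lra | lra |].
  intros y hy; rewrite <- hdrift by lra; apply hright; lra. }
assert (hglb := Glb_Rbar_correct (Dset mu sigma q g b j c)); fold (infD mu sigma q g b j c) in hglb.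
assert (hinf : exists v0, infD mu sigma q g b j c = Finite v0 /\ beta <= v0 <= c).
{ assert (h1 := proj1 hglb c hDc).
  assert (h2 : Rbar_le beta (infD mu sigma q g b j c)).
  { apply (proj2 hglb); intros x hx; apply hx. }
  destruct (infD mu sigma q g b j c) as [v0| |]; [|elim h1|elim h2].
  exists v0; repeat split; assumption. }
destruct hinf as (v0 & hinf & hv0); rewrite hinf in hL, hglb; simpl in hL.
assert (hv0c : v0 < c).
{ destruct (Rle_lt_or_eq_dec _ _ (proj2 hv0)) as [h|e]; [exact h|].
  (* If inf D were [c], this point would lie in both right neighbourhoods, where (L - q)H has
     opposite signs. *)
  set (y := c + Rmin eps e1 / 2).
  assert (hm1 := Rmin_l eps e1); assert (hm2 := Rmin_r eps e1).
  assert (hm := Rmin_glb_lt _ _ _ he he1).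
  assert (h1 := hright y ltac:(unfold y; lra)).
  assert (h2 := hL y ltac:(unfold y; lra) ltac:(unfold y; lra)); lra. }
assert (hlim : exists z, v0 < z /\ gapj v0 z <= 0).
{ apply (gap_nonpos_limit mu sigma q g hsigma hq gpos gC2 ggrowth Hj hd v0 eps);
    [lra | exact he | intros v hv; apply Hj_nonneg; lra | |].
  - intros y hy; rewrite <- hdrift by lra; apply hL; lra.
  (* Without points of D in [[v0, v0 + d)], the larger number [v0 + d] would be a lower bound of
     D. *)
  - intros d hdd; apply NNPP; intros hno.
    assert (h : v0 + d <= v0); [|lra].
    apply (proj2 hglb (Finite (v0 + d))); intros v hv; apply Rnot_lt_le; intros hlt; apply hno.
    assert (hv' : beta <= v <= c) by apply hv.
    assert (hv0v : v0 <= v) by apply (proj1 hglb v hv).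
    apply (Dset_gap c v hv') in hv; destruct hv as (z & hz); exists v, z; tauto. }
assert (hbv0 : beta < v0).
{ destruct (Rle_lt_or_eq_dec _ _ (proj1 hv0)) as [h|e]; [exact h|].
  destruct hlim as (z & hz1 & hz2); rewrite <- e in hz1, hz2.
  assert (h := hbeta z hz1); lra. }
destruct (zsup_finite mu sigma q g hsigma hq gpos gC2 b ggrowth j v0) as (r & hr);
  [lra | intros x hx; apply Hj_nonneg; lra |].
destruct (zsup_spec mu sigma q g hsigma hq gC2 b j v0 r) as (h1 & h2 & h3); [lra | exact hr |].
assert (hv0r : v0 < r).
{ assert (hD : Dset mu sigma q g b j c v0) by (apply Dset_gap; [lra | exact hlim]).
  destruct hD as [_ hD]; rewrite hr in hD; exact hD. }
exists v0, r; split; [|split; [exact hbv0 | split; [exact hv0r | split; [exact hv0c|]]]].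
- split; [|split; [|split]].
  + intros hall; assert (h := hall v1 ltac:(lra)); lra.
  + split; [split; [exact hbc | exists e1; tauto] | exact hmin].
  + exact hinf.
  + exact hr.
- apply Rle_antisym; [apply h2; lra|].
  apply F_le_diag; try assumption; apply Rnot_lt_le; intros hneg.
  destruct (continuity_pt_gap_l mu sigma q g hsigma hq gC2 Hj hd v0 r ltac:(lra)
    (- gapj v0 r)) as (d & hdd & hcont); [lra|].
  (* A strictly negative gap at [v0] would persist at this [v < v0], putting it in D below the
     infimum; the minimum keeps [v >= beta]. *)
  set (v := v0 - Rmin (d / 2) (v0 - beta)).
  assert (hm1 := Rmin_l (d / 2) (v0 - beta)); assert (hm2 := Rmin_r (d / 2) (v0 - beta)).
  assert (hm : 0 < Rmin (d / 2) (v0 - beta)) by (apply Rmin_glb_lt; lra).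
  assert (hv : beta <= v < v0) by (unfold v; lra).
  assert (hcv := hcont v); simpl in hcv; unfold D_x, no_cond, R_dist in hcv.
  assert (hva : Rabs (v - v0) < d) by (apply Rabs_def1; unfold v; lra).
  assert (hvne : v0 <> v) by lra.
  specialize (hcv (conj (conj I hvne) hva)); apply Rabs_def2 in hcv.
  assert (hDv : Dset mu sigma q g b j c v).
  { apply Dset_gap; [lra|]; exists r; split; lra. }
  assert (hle : v0 <= v) by apply (proj1 hglb v hDv); lra.
Qed.

End Step.

(** * From the barriers already produced to the next step *)

Theorem theorem4p2 (mu sigma q : R) (g : R -> R)
  (hsigma : 0 < sigma) (hq : 0 < q)
  (gpos : forall x, 0 < x -> 0 < g x)
  (gC2 : C2_pos g)
  (ggrowth : is_lim (fun z => g z / exp (Phi mu sigma q * z)) p_infty 0)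
  (k : nat) (hk : (2 <= k)%nat)
  (b : nat -> R)
  (* b_1, ..., b_{2k-1} are produced by the algorithm and well defined *)
  (hb : produced mu sigma q g b (k - 1))
  (hincr : forall i, (1 <= i < 2 * k - 1)%nat -> b i < b (i + 1)%nat)
  (hF : F mu sigma q g b (k - 2) (b (2 * k - 2)%nat) (b (2 * k - 2)%nat) =
        F mu sigma q g b (k - 2) (b (2 * k - 2)%nat) (b (2 * k - 1)%nat))
  (* the algorithm does not stop at b_{2k-1} *)
  (hpos : exists v, b (2 * k - 1)%nat < v /\
            0 < Lq mu sigma q (H mu sigma q g b (k - 1)) v)
  (* c = c_{2k-1}; inf D_{2k-1}, i.e. b_{2k}, is formed from it *)
  (c : R) (hc : is_min (Pset mu sigma q g b (k - 1)) c)
  (heps : exists eps : R, 0 < eps /\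
            forall v : R,
              Rbar_lt (infD mu sigma q g b (k - 1) c) v ->
              Rbar_lt v (Rbar_plus (infD mu sigma q g b (k - 1) c) eps) ->
              Lq mu sigma q (H mu sigma q g b (k - 1)) v < 0) :
  exists beven bodd : R,
    algorithm_step mu sigma q g b (k - 1) c beven bodd /\
    b (2 * k - 1)%nat < beven /\ beven < bodd /\ beven < c /\
    F mu sigma q g b (k - 1) beven beven = F mu sigma q g b (k - 1) beven bodd.
Proof.
destruct hb as [hb1 hprod].
assert (hint : forall X, 0 < X -> ex_RInt g 0 X).
{ intros X; apply (ex_RInt_of_is_b1 mu sigma q g hsigma hq gpos gC2 b X hb1). }
assert (b1_nonneg : 0 <= b 1%nat).
{ destruct (is_lub_Rbar_nonempty _ _ hb1) as (u & hu).
  apply Rle_trans with u; [apply hu | apply (proj1 hb1 u hu)]. }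
(* With k = i + 2 the current level is [S i], and its last two barriers come from the algorithm at
   level [i]. *)
destruct k as [|[|i]]; [lia | lia |].
replace (S (S i) - 1)%nat with (S i) in * by lia.
replace (2 * S (S i) - 1)%nat with (2 * S i + 1)%nat in * by lia.
destruct (hprod i) as (c' & _ & _ & _ & hz); [lia|].
replace (2 * i + 2)%nat with (2 * S i)%nat in hz by lia.
replace (2 * i + 3)%nat with (2 * S i + 1)%nat in hz by lia.
assert (hlt1 := hincr (2 * i + 1)%nat ltac:(lia)).
assert (hlt2 := hincr (2 * S i)%nat ltac:(lia)).
replace (2 * i + 1 + 1)%nat with (2 * S i)%nat in hlt1 by lia.
(* The preceding barrier is only known to be nonnegative, since b_1 may be 0; strictness comes from
   [hlt1]. *)
assert (heven : 0 < b (2 * S i)%nat).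
{ assert (h := H_nonneg mu sigma q g hsigma hq gpos b hint i (b (2 * i + 1)%nat) b1_nonneg
    ltac:(intros n hn; apply hincr; lia) (Rle_refl _)); lra. }
destruct (zsup_spec mu sigma q g hsigma hq gC2 b i _ _ heven hz) as (_ & _ & hmax).
apply step_exists; try assumption.
- lra.
- intros x hx; apply H_nonneg; assumption.
- intros z hbz.
  rewrite (gap_succ_at_barrier mu sigma q g hsigma hq b i _ _ z eq_refl eq_refl).
  assert (h1 := hmax z hbz); apply Rmult_lt_0_compat; [apply dWq_pos; assumption | lra].
Qed.
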